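(* Let $M$ be a set with $|M|\geq 3$ and let $d_1,d_2,d_3$ be three metrics on $M$ such that $(M,d_1)$ is complete. Let $F: M\to M$ be a mapping satisfying the following conditions: (i) for all $u\in M$, $F(Fu)\neq u$, provided $Fu\neq u$; (ii) $F$ is continuous as a mapping from $(M,d_1)$ to $(M,d_1)$; (iii) $F\in \mathcal{F}(M,d_1,d_2,d_3,\varphi)$ for some $\varphi \in \Phi$. Then $\mathrm{Fix}(F)\neq\emptyset$ and $|\mathrm{Fix}(F)|\leq 2$.
   Context: $\mathbb{R}^+=[0,\infty)$. $|A|$ denotes the cardinality of a set $A$. For $F:M\to M$, $\mathrm{Fix}(F)=\{u\in M: Fu=u\}$. $\Phi$ denotes the set of functions $\varphi:\mathbb{R}^+\to\mathbb{R}^+$ such that (C1) $\varphi$ is nondecreasing; (C2) $\sum_{n\geq 1}\varphi^n(s)<\infty$ for every $s>0$, where $\varphi^n$ is the $n$-fold iterate of $\varphi$ ($\varphi^0$ is the identity, $\varphi^{n+1}=\varphi\circ\varphi^n$). For three metrics $d_1,d_2,d_3$ on $M$ with $|M|\geq 3$ and $\varphi\in\Phi$, $\mathcal{F}(M,d_1,d_2,d_3,\varphi)$ denotes the class of mappings $F:M\to M$ satisfying $$d_1(Fx,Fy)+d_2(Fy,Fz)+d_3(Fz,Fx)\leq \varphi\left(d_1(x,y)+d_2(y,z)+d_3(z,x)\right)$$ for every three pairwise distinct points $x,y,z\in M$. *)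

(* Defs.v *)
From HB Require Import structures.
From mathcomp Require Import all_boot all_order all_algebra.
From mathcomp Require Import all_classical all_reals all_analysis.

Set Implicit Arguments.
Unset Strict Implicit.
Unset Printing Implicit Defensive.

Import Order.TTheory GRing.Theory Num.Theory.

Local Open Scope classical_set_scope.
Local Open Scope ring_scope.

(* Several metrics live on the same carrier, so a metric is a first-class value
   here; [metric_space d] below turns it into a [metricType]. *)
Record metric (R : realType) (M : Type) := Metric {
  dist :> M -> M -> R ;
  dist_ge0 : forall x y, 0 <= dist x y ;
  dist_eq0 : forall x y, dist x y = 0 <-> x = y ;
  dist_sym : forall x y, dist x y = dist y x ;
  dist_triangle : forall y x z, dist x z <= dist x y + dist y z
}.

(* The alias carries [d] so that topological notions on [metric_space d] are
   those of the metric [d]. *)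
Definition metric_space (R : realType) (M : Type) (d : metric R M) : Type := M.

Section MetricSpace.
Context (R : realType) (M : Type) (d : metric R M).

Let distxx (x : M) : d x x = 0.
Proof. exact/dist_eq0. Qed.

Let dist_positivity (x y : M) : d x y = 0 -> x = y.
Proof. by move/dist_eq0. Qed.

HB.instance Definition _ := gen_eqMixin (metric_space d).
HB.instance Definition _ := gen_choiceMixin (metric_space d).
HB.instance Definition _ := @isMetric.Build R (metric_space d)
  (dist d) distxx dist_positivity (dist_sym d) (dist_triangle d).

End MetricSpace.

(* The library's [completeType] is a structure on pointed types quantifying over
   proper filters, and [cvg] also needs a point; this is the usual sequential
   definition, with [cauchy] and [-->] those of [metric_space d]. *)
Definition complete_metric (R : realType) (M : Type) (d : metric R M) : Prop :=
  forall u : nat -> metric_space d, cauchy (u @ \oo) ->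
    exists l : metric_space d, u @ \oo --> l.

Definition continuous_metric (R : realType) (M : Type) (d : metric R M)
    (F : M -> M) : Prop :=
  continuous (F : metric_space d -> metric_space d).

Definition Fix (M : Type) (F : M -> M) : set M := [set u | F u = u].

(* A function from [0, oo[ to itself is a total function on R preserving
   [0, oo[; its values on negative reals are never used. *)
Definition Phi (R : realType) : set (R -> R) :=
  [set phi | [/\ set_fun `[0, +oo[ `[0, +oo[ phi,
                 {in `[0, +oo[ &, {homo phi : s t / s <= t}} &
                 forall s : R, 0 < s ->
                   (\sum_(1 <= n <oo) (iter n phi s)%:E < +oo)%E ] ].

Definition class_F (R : realType) (M : Type) (d1 d2 d3 : metric R M)
    (phi : R -> R) : set (M -> M) :=
  [set F | forall x y z : M, x <> y -> y <> z -> z <> x ->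
    d1 (F x) (F y) + d2 (F y) (F z) + d3 (F z) (F x)
      <= phi (d1 x y + d2 y z + d3 z x)].

(* Main.v *)
(* If F had no fixed point then, as there are no 2-cycles, any three consecutive
   points of an orbit x_n = F^n(x_0) would be pairwise distinct. The perimeters
   p_n = d1(x_n,x_{n+1}) + d2(x_{n+1},x_{n+2}) + d3(x_{n+2},x_n) then satisfy
   p_{n+1} <= phi(p_n), hence p_n <= phi^n(p_0) is summable; so the orbit is
   d1-Cauchy and its limit is fixed by continuity. Three distinct fixed points
   would give p <= phi(p) for their perimeter p > 0, so the constant sequence p
   would be summable. *)

Require Import Defs.
From HB Require Import structures.
From mathcomp Require Import all_boot all_order all_algebra.
From mathcomp Require Import all_classical all_reals all_analysis.

Set Implicit Arguments.
Unset Strict Implicit.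
Unset Printing Implicit Defensive.

Import Order.TTheory GRing.Theory Num.Theory.
Import numFieldNormedType.Exports.

Local Open Scope classical_set_scope.
Local Open Scope card_scope.
Local Open Scope ring_scope.

(** Fix [a] in [A] and send [a] to 0, every other point to 1. This is injective on [A]: two distinct
    points other than [a] would form a forbidden triple with it. *)
Lemma card_le_I2 (T : Type) (A : set T) :
  (forall a b c, A a -> A b -> A c -> a <> b -> b <> c -> c <> a -> False) ->
  A #<= `I_2.
Proof.
move=> A2.
have [->|/set0P[a Aa]] := eqVneq A set0; first exact: card_ge0.
pose f x := if `[< x = a >] then 0%N else 1%N.
have f_inj : {in A &, injective f}.
  move=> x y /set_mem Ax /set_mem Ay; rewrite /f.
  case: asboolP => [->|xa]; case: asboolP => // ya _.
  by apply: contrapT => xy; apply: (A2 a x y) => //; exact/nesym.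
rewrite -(card_le_eql (inj_card_eq f_inj)); apply: subset_card_le.
by move=> _ [x _ <-]; rewrite /f /=; case: asboolP.
Qed.

Section Phi_summable.
Context {R : realType} (phi : R -> R) (Phi_phi : Phi phi).

Lemma Phi_iter_ge0 (s : R) n : 0 <= s -> 0 <= iter n phi s.
Proof.
case: Phi_phi => phi_ge0 _ _ s0; elim: n => //= n IHn.
have := phi_ge0 (iter n phi s).
by rewrite /= !in_itv/= !andbT; apply.
Qed.

Lemma Phi_is_cvg_series_iter (s : R) :
  0 < s -> cvgn (series (fun n => iter n phi s)).
Proof.
case: (Phi_phi) => _ _ phi_sum s0.
have iter_ge0 n : 0 <= iter n phi s by apply: Phi_iter_ge0; exact: ltW.
apply: nnseries_is_cvg => //.
(* The sum in [Phi] starts at index 1; the finite term [s] of index 0 is split off. *)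
rewrite (nneseries_split _ 1) => [|n _]; last by rewrite lee_fin.
rewrite add0n big_nat1 lte_add_pinfty ?ltry//.
exact: phi_sum.
Qed.

(** Since [phi] is nondecreasing, induction gives [u n <= iter n phi (u 0)], and comparison
    concludes. This serves both the perimeters along an orbit and a constant sequence. *)
Lemma Phi_is_cvg_series (u : R^nat) :
  (forall n, 0 <= u n) -> 0 < u 0%N -> (forall n, u n.+1 <= phi (u n)) ->
  cvgn (series u).
Proof.
move=> u_ge0 u0_gt0 u_phi.
have iter_ge0 n : 0 <= iter n phi (u 0%N) by exact/Phi_iter_ge0/u_ge0.
apply: (series_le_cvg u_ge0 iter_ge0); last exact: Phi_is_cvg_series_iter.
elim=> // n IHn; apply: (le_trans (u_phi n)) => /=.
by case: Phi_phi => _ + _; apply; rewrite // in_itv/= andbT.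
Qed.

End Phi_summable.

Lemma cauchy_summable_steps {R : realType} {T : metricType R}
    (x : nat -> T) (a : R^nat) :
  (forall n, mdist (x n) (x n.+1) <= a n) -> cvgn (series a) ->
  cauchy (x @ \oo).
Proof.
move=> xa a_cvg; apply: cauchy_exP => e e0.
have a_ge0 n : 0 <= a n by apply: le_trans (xa n); exact: mdist_ge0.
have ndS : nondecreasing_seq (series a).
  by apply/nondecreasing_seqP => n; rewrite /series/= big_nat_recr//= lerDl.
have xS n k : mdist (x n) (x (n + k)%N) <= series a (n + k)%N - series a n.
  elim: k => [|k IHk]; first by rewrite addn0 mdistxx subrr.
  rewrite addnS (le_trans (metric_triangle _ (x (n + k)%N) _))//.
  rewrite (le_trans (lerD IHk (xa _)))// [series a (n + k).+1]/series/=.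
  by rewrite big_nat_recr//= addrAC.
(* The partial sums increase to their limit, so beyond such an [N] they grow by less than [e]; by
   [xS] the ball of radius [e] around [x N] then contains the tail. *)
have [N _ SN] : \forall N \near \oo, limn (series a) - e < series a N.
  by apply: (cvgr_gt _ a_cvg); rewrite ltrBlDr ltrDl.
exists (x N); exists N => // n /= Nn; rewrite ballEmdist/=.
have := xS N (n - N)%N; rewrite subnKC// => /le_lt_trans; apply.
rewrite ltrBlDr (le_lt_trans (nondecreasing_cvgn_le ndS a_cvg _))//.
by rewrite -ltrBlDl; apply: SN => /=.
Qed.

Section ThreeMetrics.
Context {R : realType} {M : Type} (d1 d2 d3 : metric R M) (phi : R -> R).
Context (F : M -> M) (Phi_phi : Phi phi) (F_class : class_F d1 d2 d3 phi F).

Let perimeter x y z := d1 x y + d2 y z + d3 z x.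

Let dist_gt0 (d : metric R M) x y : x <> y -> 0 < d x y.
Proof.
by move=> xy; rewrite lt_neqAle dist_ge0 andbT; apply/eqP => /esym/dist_eq0.
Qed.

Let perimeter_gt0 x y z : x <> y -> 0 < perimeter x y z.
Proof. by move=> xy; rewrite !ltr_pwDl ?dist_ge0 ?dist_gt0. Qed.

Let perimeter_ge0 x y z : 0 <= perimeter x y z.
Proof. by rewrite !addr_ge0 ?dist_ge0. Qed.

Lemma class_F_no_three_fixpoints x y z : Fix F x -> Fix F y -> Fix F z ->
  x <> y -> y <> z -> z <> x -> False.
Proof.
move=> Fx Fy Fz xy yz zx.
have p_gt0 := perimeter_gt0 z xy.
have p_phi : perimeter x y z <= phi (perimeter x y z).
  by have := F_class xy yz zx; rewrite Fx Fy Fz.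
have /cvg_series_cvg_0 : cvgn (series (fun=> perimeter x y z)).
  by apply: (Phi_is_cvg_series Phi_phi) => // n; exact: ltW.
move/(cvg_unique _ (cvg_cst _)) => p0.
by move: p_gt0; rewrite p0 ?ltxx//; exact: norm_hausdorff.
Qed.

Lemma cauchy_class_F_orbit (x0 : M) :
  (forall x, F x <> x) -> (forall x, F (F x) <> x) ->
  cauchy ((fun n => iter n F x0 : metric_space d1) @ \oo).
Proof.
move=> F1 F2.
pose x n := iter n F x0.
pose p n := perimeter (x n) (x n.+1) (x n.+2).
have x1 n : x n <> x n.+1 by move/esym; exact: F1.
apply: (@cauchy_summable_steps _ (metric_space d1) _ p) => [n|].
  (* [mdist] on [metric_space d1] unfolds to [d1], the first summand of the perimeter. *)
  change (d1 (x n) (x n.+1) <= p n).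
  by rewrite /p /perimeter -addrA lerDl addr_ge0 ?dist_ge0.
apply: (Phi_is_cvg_series Phi_phi) => [n||n].
- exact: perimeter_ge0.
- exact: perimeter_gt0.
(* Applying [F] to the triple behind [p n] gives the one behind [p n.+1]. *)
- exact: F_class (x1 n) (x1 n.+1) (F2 (x n)).
Qed.

End ThreeMetrics.

(** The shifted orbit tends to [F l] by continuity and to [l] as a tail of the orbit; limits are
    unique in a Hausdorff space. *)
Lemma cvg_orbit_fixpoint (T : topologicalType) (F : T -> T) (x0 l : T) :
  hausdorff_space T -> continuous F -> (iter n F x0 @[n --> \oo] --> l) ->
  F l = l.
Proof.
move=> hT cF xl.
apply: (cvg_unique hT (F := iter n.+1 F x0 @[n --> \oo])).
  exact: (cvg_comp _ _ xl (cF l)).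
have -> : (fun n => iter n.+1 F x0) = (fun n => iter (n + 1) F x0).
  by apply/funext => n; rewrite addn1.
exact: (cvg_comp _ _ (cvg_addnr 1) xl).
Qed.

Theorem theorem2p8 (R : realType) (M : Type) (cardM : `I_3 #<= [set: M])
  (d1 d2 d3 : metric R M) (d1_complete : complete_metric d1)
  (F : M -> M)
  (F_no_2cycle : forall u : M, F u <> u -> F (F u) <> u)
  (F_cont : continuous_metric d1 F)
  (F_class : exists2 phi : R -> R, Phi phi & class_F d1 d2 d3 phi F) :
  Fix F !=set0 /\ Fix F #<= `I_2.
Proof.
have [phi Phi_phi F_phi] := F_class; split; last first.
  by apply: card_le_I2; exact: class_F_no_three_fixpoints Phi_phi F_phi.
have [x0 _] : [set: M] !=set0.
  apply/set0P/negP => /eqP M0; move: cardM; rewrite M0 => /card_le0P I30.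
  by have : `I_3 0%N by []; rewrite I30.
apply: contrapT => noFix.
have F1 x : F x <> x by move=> Fx; apply: noFix; exists x.
have F2 x : F (F x) <> x by exact: F_no_2cycle.
have [l xl] := d1_complete _ (cauchy_class_F_orbit Phi_phi F_phi x0 F1 F2).
exact: F1 (cvg_orbit_fixpoint (@metric_hausdorff _ _) F_cont xl).
Qed.
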